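(* For every positive integer $n$, there exists a positive integer $k$ such that $n$ is a $k$-congruent number.
   Context: Let $k\ge 1$ be an integer. A positive integer $n$ is called a $k$-congruent number if it is the area of a right trapezoid with parallel sides $a,d$, height $b$ and slanted side $c$, where $a,b,c,d$ are positive rational numbers and $a=kd$; that is, if there exist positive rational numbers $a,b,c,d$ with $a=kd$, $n=\frac{(a+d)b}{2}$ and $(a-d)^2+b^2=c^2$. (For $k=1$ the trapezoid degenerates into a rectangle, which is allowed.) *)

(* Defs.v *)
From mathcomp Require Import all_boot all_order all_algebra.

Set Implicit Arguments.
Unset Strict Implicit.
Unset Printing Implicit Defensive.

Import Order.TTheory GRing.Theory Num.Theory.

Local Open Scope ring_scope.

(* [a] and [d] are the parallel sides, [b] the height (the side perpendicular
   to them) and [c] the slanted side.  For [k = 1] the trapezoid is a rectangle,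
   which is allowed. *)
Definition k_congruent (k n : nat) : Prop :=
  [/\ (0 < k)%N, (0 < n)%N &
    exists a b c d : rat,
      (0 < a /\ 0 < b /\ 0 < c /\ 0 < d) /\
      a = k%:R * d /\
      n%:R = (a + d) * b / 2%:R /\
      (a - d) ^+ 2 + b ^+ 2 = c ^+ 2].

(* Main.v *)
Require Import Defs.
From mathcomp Require Import all_boot all_order all_algebra.
From mathcomp Require Import ring lra.

Import GRing.Theory Num.Theory.
Local Open Scope ring_scope.

(** One may take [k = n]. With [d = 1] and [b = 2n / (k + 1)] the area is [n],
    and after scaling by [k + 1] the slanted side must be the hypotenuse of a
    right triangle (degenerate when [k = 1]) with legs [k ^ 2 - 1] and [2n]. For [k = n] this is the
    Pythagorean triple [(n ^ 2 - 1) ^ 2 + (2n) ^ 2 = (n ^ 2 + 1) ^ 2]. *)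
Theorem proposition1p5 :
  forall n : nat, (0 < n)%N -> exists k : nat, (0 < k)%N /\ k_congruent k n.
Proof.
move=> n n_gt0; exists n; split=> //; split=> //.
have: 0 < n%:R :> rat by rewrite ltr0n.
move: (n%:R : rat) => x x_gt0.
have x1_gt0 : 0 < x + 1 by lra.
have x1_neq0 : x + 1 != 0 by rewrite lt0r_neq0.
exists x, (2 * x / (x + 1)), ((x ^+ 2 + 1) / (x + 1)), 1.
split; last by split; [rewrite mulr1 | split; field].
split=> //; split; first by rewrite divr_gt0 // mulr_gt0.
by split=> //; rewrite divr_gt0 // addr_gt0 // exprn_gt0.
Qed.
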